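(* Let $(\mu_1,L_1),\dots,(\mu_n,L_n)$ be pairs of positive numbers with $\mu_i\le L_i$, let $d\ge1$, $x^*\in\mathbb{R}^d$, $R>0$, and $D_R(x^* )=\{x\in\mathbb{R}^d:\|x-x^*\|_2\le R\}$. Let $\mathcal{P}$ be the set of valid problems: all $F=\sum_{i=1}^nf_i$ on $\mathbb{R}^d$ such that each $f_i:\mathbb{R}^d\to\mathbb{R}$ is $\mu_i$-strongly convex with $L_i$-Lipschitz continuous gradient, and $x^*$ minimizes every $f_i$ simultaneously. Then for every step size $0<\gamma\le\min_i\frac{2}{L_i+\mu_i}$ and every integer $T\ge1$, $$\max_{P\in\mathcal{P},\,x_0\in D_R(x^* )}\mathbb{E}\big[\|X_{RS}(T,x_0,\gamma,P)-x^*\|^2\big]\le\max_{P\in\mathcal{P},\,x_0\in D_R(x^* )}\mathbb{E}\big[\|X_{SGD}(T,x_0,\gamma,P)-x^*\|^2\big].$$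
   Context: $X_{SGD}(T,x_0,\gamma,P)$ is the random point $x_T$ obtained from $x_0$ by running $x_k=x_{k-1}-\gamma\nabla f_{s(k)}(x_{k-1})$ for $k=1,\dots,T$, where the $s(k)$ are independent and uniform on $\{1,\dots,n\}$ (with-replacement SGD). $X_{RS}(T,x_0,\gamma,P)$ is the random point $x_T$ obtained by the same recursion, but with indices sampled without replacement in each epoch (RandomShuffle): for each $t\ge1$ an independent uniformly random permutation $\sigma_t$ of $\{1,\dots,n\}$ is drawn and $s((t-1)n+k)=\sigma_t(k)$ for $1\le k\le n$. Here $T$ is arbitrary and need not be a multiple of $n$ (the last epoch may be incomplete). A function $f$ is $\mu$-strongly convex if $f(x)\ge f(y)+\langle\nabla f(y),x-y\rangle+\frac\mu2\|x-y\|^2$ for all $x,y$. *)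

(* Defs.v *)
From HB Require Import structures.
From mathcomp Require Import all_boot all_order all_algebra all_fingroup.
From mathcomp Require Import finmap.
From mathcomp Require Import all_classical all_reals all_analysis.

Set Implicit Arguments.
Unset Strict Implicit.
Unset Printing Implicit Defensive.

Import Order.TTheory GRing.Theory Num.Theory.
Import numFieldNormedType.Exports.

Local Open Scope classical_set_scope.
Local Open Scope ring_scope.

Section Euclidean.
Context {R : realType} {d : nat}.
Implicit Types (x y : 'rV[R]_d) (f : 'rV[R]_d -> R).

Definition inner x y : R := \sum_(j < d) x 0 j * y 0 j.

(* The library norm `|x| on 'rV[R]_d is the sup norm, hence a separate
   Euclidean norm; both induce the same topology, so [differentiable] below has
   its usual meaning. *)
Definition norm2 x : R := Num.sqrt (inner x x).

(* Meaningful at points of differentiability. *)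
Definition grad f x : 'rV[R]_d := \row_(j < d) 'D_(delta_mx 0 j) f x.

Definition strongly_convex (m : R) f :=
  forall x y,
    f x >= f y + inner (grad f y) (x - y) + m / 2 * norm2 (x - y) ^+ 2.

Definition lipschitz_grad (L : R) f :=
  (forall x, differentiable f x) /\
  (forall x y, norm2 (grad f x - grad f y) <= L * norm2 (x - y)).

Definition minimizer f x := forall y, f x <= f y.

End Euclidean.

(* A problem F = \sum_i f i is represented by its family of components f; the
   decomposition determines F and is all that the algorithms access. *)
Definition valid_problem {R : realType} {n d : nat} (mu L : 'I_n -> R)
    (xstar : 'rV[R]_d) (f : 'I_n -> 'rV[R]_d -> R) :=
  forall i, [/\ strongly_convex (mu i) (f i), lipschitz_grad (L i) (f i)
              & minimizer (f i) xstar].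

(* Steps are numbered from 0: the (k+1)-st step uses the index s k. *)
Fixpoint iterate {R : realType} {n d : nat} (f : 'I_n -> 'rV[R]_d -> R)
    (gamma : R) (x0 : 'rV[R]_d) (s : nat -> 'I_n) (k : nat) : 'rV[R]_d :=
  if k is k'.+1 then
    let x := iterate f gamma x0 s k' in x - gamma *: grad (f (s k')) x
  else x0.

Section Sampling.
Context {R : realType} {disp : measure_display} {Omega : measurableType disp}.
Variable P : probability Omega R.

(* V carries the discrete sigma-algebra. *)
Definition random_elements {V : finType} (X : nat -> Omega -> V) :=
  forall k v, measurable (X k @^-1` [set v]).

Definition uniform_elements {V : finType} (X : nat -> Omega -> V) :=
  forall k v, P (X k @^-1` [set v]) = (#|V|%:R^-1)%:E.

Definition mutually_independent {V : finType} (X : nat -> Omega -> V) :=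
  forall (J : {fset nat}) (A : nat -> set V),
    P (\bigcap_(k in [set` J]) (X k @^-1` A k)) =
    (\prod_(k <- J) P (X k @^-1` A k))%E.

Definition iid_uniform {V : finType} (X : nat -> Omega -> V) :=
  [/\ random_elements X, uniform_elements X & mutually_independent X].

Definition with_replacement {n : nat} (s : nat -> Omega -> 'I_n) :=
  iid_uniform s.

(* With epochs also numbered from 0, epoch t consists of the steps
   t * n + k, k < n. *)
Definition random_shuffle {n : nat} (s : nat -> Omega -> 'I_n) :=
  exists sigma : nat -> Omega -> {perm 'I_n},
    iid_uniform sigma /\
    forall (t : nat) (k : 'I_n) (w : Omega), s (t * n + k)%N w = sigma t w k.

(* E[||x_T - xstar||^2], where x_T is the iterate driven by the random
   indices s. *)
Definition expected_sqdist {n d : nat} (s : nat -> Omega -> 'I_n)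
    (f : 'I_n -> 'rV[R]_d -> R) (gamma : R) (x0 xstar : 'rV[R]_d) (T : nat)
    : \bar R :=
  ('E_P[(fun w => norm2 (iterate f gamma x0 (s^~ w) T - xstar) ^+ 2)%R])%E.

Definition expected_sqdists {n d : nat} (mu L : 'I_n -> R) (xstar : 'rV[R]_d)
    (r gamma : R) (T : nat) (s : nat -> Omega -> 'I_n) : set (\bar R) :=
  [set e | exists (f : 'I_n -> 'rV[R]_d -> R) (x0 : 'rV[R]_d),
     [/\ valid_problem mu L xstar f, norm2 (x0 - xstar) <= r
       & e = expected_sqdist s f gamma x0 xstar T]].

End Sampling.

Definition is_max {R : realType} (S : set (\bar R)) (m : \bar R) :=
  S m /\ ubound S m.

(* Main.v *)
Require Import Defs.
From mathcomp Require Import all_boot all_order all_algebra all_fingroup.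
From mathcomp Require Import all_classical all_reals all_analysis.
From mathcomp Require Import finmap.
From mathcomp Require Import measurable_realfun ring lra zify.
Import Order.TTheory GRing.Theory Num.Theory.
Import numFieldNormedType.Exports.
Local Open Scope classical_set_scope.
Local Open Scope ring_scope.

(** Every component shares the minimizer [xstar], so a gradient step on
    component [i] moves the iterate towards [xstar] by a factor depending on [i]
    alone: if [0 <= gamma <= 2 / (L i + mu i)], the squared distance to [xstar]
    is multiplied by at most [a i := (1 - gamma * mu i) ^+ 2]
    ([gradient_step_contraction]). The quadratic
    [x |-> mu i / 2 * |x - xstar|^2] is a valid component for which the
    multiplier is exactly [a i] ([iterate_sqdist_quadratic]). Hence, whatever
    the law of the indices [s 0, s 1, ...], the family of these quadratics,
    started at distance [r], is a worst case, for every realisation of the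
    indices at once, and the maximum is [r ^+ 2] times the expectation of
    [\prod_(k < T) a (s k)] ([is_max_expected_sqdists]).

    It remains to compare two expectations of products. For independent indices
    it is [A ^+ T], where [A] is the mean of the [a i]. For shuffled indices it
    factors over the epochs, and an epoch of which [c] steps are used
    contributes the mean of [\prod_(k < c) a (sigma k)] over all permutations
    [sigma], which is the normalised elementary symmetric polynomial of degree
    [c] at [a]; by Maclaurin's inequality it is at most [A ^+ c]
    ([maclaurin_perm]). The values of [c] add up to [T], so the shuffled
    expectation is at most [A ^+ T] ([shuffle_sum_le]).

    Maclaurin's inequality comes from a negative correlation: weighting the
    permutations by [\prod_(k < c) a (sigma k)] makes the values at the
    positions before [c] larger on average than those at later positions, as
    seen by exchanging two positions ([sum_perm_next_le]). *)

(** * The Euclidean inner product *)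

Section InnerProduct.
Context {R : realType} {d : nat}.
Implicit Types (x y z u v : 'rV[R]_d) (a c : R).

Lemma innerC x y : inner x y = inner y x.
Proof. by apply: eq_bigr => j _; rewrite mulrC. Qed.

Lemma innerDl x y z : inner (x + y) z = inner x z + inner y z.
Proof. by rewrite -big_split; apply: eq_bigr => j _; rewrite mxE mulrDl. Qed.

Lemma innerZl a x y : inner (a *: x) y = a * inner x y.
Proof. by rewrite mulr_sumr; apply: eq_bigr => j _; rewrite mxE mulrA. Qed.

Lemma innerNl x y : inner (- x) y = - inner x y.
Proof. by rewrite -scaleN1r innerZl mulN1r. Qed.

Lemma innerDr x y z : inner x (y + z) = inner x y + inner x z.
Proof. by rewrite innerC innerDl !(innerC x). Qed.

Lemma innerZr a x y : inner x (a *: y) = a * inner x y.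
Proof. by rewrite innerC innerZl innerC. Qed.

Lemma innerNr x y : inner x (- y) = - inner x y.
Proof. by rewrite innerC innerNl innerC. Qed.

Definition innerE := (innerDl, innerDr, innerNl, innerNr, innerZl, innerZr).

Lemma inner_ge0 x : 0 <= inner x x.
Proof. by apply: sumr_ge0 => j _; rewrite -expr2 sqr_ge0. Qed.

Lemma inner_eq0 x : inner x x = 0 -> x = 0.
Proof.
move/eqP; rewrite psumr_eq0 => [|j _]; last by rewrite -expr2 sqr_ge0.
move=> /allP x0; apply/rowP => j; rewrite mxE.
by have := x0 j (mem_index_enum j); rewrite -expr2 sqrf_eq0 => /eqP.
Qed.

Lemma norm2_ge0 x : 0 <= norm2 x.
Proof. exact: sqrtr_ge0. Qed.

Lemma norm2_sqr x : norm2 x ^+ 2 = inner x x.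
Proof. by rewrite sqr_sqrtr ?inner_ge0. Qed.

(** A form of Cauchy-Schwarz without square roots, read off from
    [0 <= inner (u - c *: v) (u - c *: v)]. *)
Lemma inner_le_sqr c u v : 0 < c ->
  inner u u <= c ^+ 2 * inner v v -> inner u v <= c * inner v v.
Proof.
move=> c0 huv; have := inner_ge0 (u - c *: v); rewrite !innerE (innerC v u).
by move=> h; rewrite -(ler_pM2l c0); nra.
Qed.

End InnerProduct.

(** * Contraction of a gradient step *)

Section Contraction.
Context {R : realType} {d : nat}.
Implicit Types (x y v : 'rV[R]_d) (f : 'rV[R]_d -> R).

Lemma le_of_le_divn (a b c : R) :
  (forall N : nat, a <= b + c / N.+1%:R) -> a <= b.
Proof.
move=> h; rewrite leNgt; apply/negP => ab.
have ba0 : 0 < a - b by rewrite subr_gt0.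
have hN := truncnS_gt (c / (a - b)).
have := h (Num.trunc (c / (a - b))).
rewrite -lerBlDl ler_pdivlMr ?ltr0Sn// mulrC => hc.
by move: hN; rewrite ltr_pdivrMr// ltNge hc.
Qed.

(** The classical quadratic upper bound is usually obtained by integrating the
    gradient along the segment. Convexity gives it from a Riemann sum instead:
    on each piece of a subdivision, the increment of [f] is at most the slope
    at the right end. *)
Lemma smooth_upper_bound f (m L : R) x v : 0 <= m -> 0 < L ->
  strongly_convex m f -> lipschitz_grad L f ->
  f (x + v) <= f x + inner (grad f x) v + L / 2 * inner v v.
Proof.
move=> m0 L0 fm [_ fL]; apply: (@le_of_le_divn _ _ (L / 2 * inner v v)) => N.
set h : R := N.+1%:R^-1; have h0 : 0 < h by rewrite invr_gt0 ltr0Sn.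
have Lsq y z : inner (grad f y - grad f z) (grad f y - grad f z)
    <= L ^+ 2 * inner (y - z) (y - z).
  rewrite -!norm2_sqr -exprMn.
  by rewrite lerXn2r ?nnegrE ?norm2_ge0 ?mulr_ge0 ?norm2_ge0// ltW.
(* The last factor is the sum of the integers up to k. *)
have step k : f (x + (k%:R * h) *: v) <= f x + (k%:R * h) * inner (grad f x) v
    + L * inner v v * h ^+ 2 * (k%:R * (k%:R + 1) / 2).
  elim: k => [|k ih]; first by rewrite !mul0r scale0r !addr0 mulr0 addr0.
  have c0 : 0 < L * (k.+1%:R * h) by rewrite !mulr_gt0// ltr0Sn.
  have xv : x + (k.+1%:R * h) *: v - x = (k.+1%:R * h) *: v.
    by rewrite addrC addKr.
  have slope : inner (grad f (x + (k.+1%:R * h) *: v) - grad f x) v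
      <= L * (k.+1%:R * h) * inner v v.
    apply: inner_le_sqr => //; apply: le_trans (Lsq _ _) _.
    by rewrite xv !innerE le_eqVlt; apply/orP; left; apply/eqP; ring.
  have := fm (x + (k%:R * h) *: v) (x + (k.+1%:R * h) *: v).
  have -> : x + (k%:R * h) *: v - (x + (k.+1%:R * h) *: v) = - (h *: v).
    rewrite opprD addrACA subrr add0r -scalerBl -natr1 mulrDl mul1r.
    by rewrite opprD addrA subrr add0r -scaleNr.
  rewrite norm2_sqr !innerE; rewrite !innerE in slope.
  have := mulr_ge0 (mulr_ge0 m0 (sqr_ge0 h)) (inner_ge0 v).
  rewrite -natr1 in slope *; move: slope ih.
  move: (inner (grad f _) v) (inner (grad f x) v) (inner v v) (f _) (f _) (f x).
  move=> s s0 V fk fk1 f0 slope ih mV hf.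
  have hs := ler_wpM2l (ltW h0) slope; nra.
have := step N.+1; rewrite -natr1 mulrDl.
have Nh : N%:R * h = 1 - h.
  by rewrite -[N%:R](addrK 1) natr1 mulrBl divff ?mul1r ?pnatr_eq0.
rewrite Nh mul1r subrK scale1r.
have -> : L * inner v v * h ^+ 2 * ((N%:R + 1) * (N%:R + 1 + 1) / 2) =
    L / 2 * inner v v * ((N%:R * h + h) * (N%:R * h + h + h)) by field.
by rewrite Nh subrK mul1r mul1r mulrDr mulr1 addrA.
Qed.

(** Otherwise a step of length [L^-1] against the gradient would decrease [f],
    by the quadratic upper bound. *)
Lemma grad_minimizer f (m L : R) x : 0 <= m -> 0 < L ->
  strongly_convex m f -> lipschitz_grad L f -> minimizer f x -> grad f x = 0.
Proof.
move=> m0 L0 fm fL xmin; apply: inner_eq0; apply/eqP.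
rewrite eq_le inner_ge0 andbT.
have := smooth_upper_bound f m L x (- L^-1 *: grad f x) m0 L0 fm fL.
have := xmin (x + - L^-1 *: grad f x); rewrite !innerE.
move: (inner _ _) => g h1 h2; have := le_trans h1 h2.
have -> : f x + - L^-1 * g + L / 2 * (- L^-1 * (- L^-1 * g)) = f x - L^-1 * g / 2.
  by field; rewrite gt_eqF.
by rewrite lerDl oppr_ge0 -mulrA pmulr_rle0 ?invr_gt0// pmulr_lle0.
Qed.

(** This is the cocoercivity of the gradient of the convex function
    [g := f - m / 2 * |. - xs|^2], whose gradient is [(L - m)]-Lipschitz,
    between [x] and the minimizer [xs]. With [h] the gradient of [g] at [x], the
    convexity of [g] and its quadratic upper bound are compared at the two
    points [x - t *: h] and [xs + t *: h]; everything is written in terms of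
    [f]. *)
Lemma cocoercive_minimizer f (m L : R) x xs : 0 <= m -> m <= L -> 0 < L ->
  strongly_convex m f -> lipschitz_grad L f -> minimizer f xs ->
  inner (grad f x) (grad f x) + m * L * inner (x - xs) (x - xs)
    <= (m + L) * inner (grad f x) (x - xs).
Proof.
move=> m0 mL L0 fm fL xmin.
have g0 := grad_minimizer f m L xs m0 L0 fm fL xmin.
have up := smooth_upper_bound f m L _ _ m0 L0 fm fL.
set G := grad f x; have [D DE] : exists D, D = x - xs by exists (x - xs).
have [h hE] : exists h, h = G - m *: D by exists (G - m *: D).
have key t : 2 * t * inner h h - (L - m) * t ^+ 2 * inner h h <= inner h D.
  have i1 := fm (x + - t *: h) xs.
  have i2 := up x (- t *: h).
  have i3 := fm (xs + t *: h) x.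
  have i4 := up xs (t *: h).
  have e1 : x + - t *: h - xs = D - t *: h by rewrite DE scaleNr addrAC.
  have e2 : xs + t *: h - x = t *: h - D by rewrite DE opprB addrCA addrA.
  move: i1 i2 i3 i4; rewrite g0 e1 e2 !norm2_sqr -/G.
  have -> : inner (0 : 'rV[R]_d) = fun=> 0.
    by apply/funext => y; rewrite -[0](scale0r 0) innerZl mul0r.
  have eh y : inner h y = inner G y - m * inner D y by rewrite hE !innerE.
  rewrite !innerE !(innerC _ h) !eh !(innerC _ h) !eh !(innerC D G).
  move: (f (x + _)) (f (xs + _)) (f x) (f xs) (inner G G) (inner G D) (inner D D).
  move=> f1 f2 f3 f4 a b c i1 i2 i3 i4; lra.
rewrite -DE; have hM : inner h h <= (L - m) * inner h D.
  move: mL; rewrite le_eqVlt => /orP[/eqP mL|mL]; last first.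
    (* This t maximizes the left-hand side of key. *)
    have M0 : 0 < L - m by rewrite subr_gt0.
    have := key (L - m)^-1; rewrite -(ler_pM2l M0); congr (_ <= _).
    by field; rewrite gt_eqF.
  move: key; rewrite mL subrr mul0r => key.
  (* If L = m, the bound key is linear in t, so inner h h must vanish. *)
  rewrite leNgt; apply/negP => q0.
  have := key (inner h D / inner h h); have := key 1.
  have -> : 2 * (inner h D / inner h h) * inner h h = 2 * inner h D.
    by field; rewrite gt_eqF.
  by move: q0; clear; move: (inner h h) (inner h D) => q p; lra.
move: hM; rewrite hE !innerE (innerC D G).
by move: (inner G G) (inner G D) (inner D D) => a b c; lra.
Qed.

(** Expanding the square, cocoercivity bounds the cross term, and what is left
    is, up to the positive factor [L + m], the product of [c * (2 - c * (L + m))]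
    and the excess of the squared norm of the gradient over
    [m ^+ 2 * |x - xs|^2]; the excess is nonnegative by strong convexity. *)
Lemma gradient_step_contraction f (m L c : R) x xs : 0 < m -> m <= L ->
  strongly_convex m f -> lipschitz_grad L f -> minimizer f xs ->
  0 <= c -> c <= 2 / (L + m) ->
  norm2 (x - c *: grad f x - xs) ^+ 2 <= (1 - c * m) ^+ 2 * norm2 (x - xs) ^+ 2.
Proof.
move=> m0 mL fm fL xmin c0 hc; have L0 := lt_le_trans m0 mL.
have coc := cocoercive_minimizer f m L x xs (ltW m0) mL L0 fm fL xmin.
have -> : x - c *: grad f x - xs = (x - xs) - c *: grad f x by rewrite addrAC.
have mono : m * inner (x - xs) (x - xs) <= inner (grad f x) (x - xs).
  have := fm xs x; have := fm x xs.
  rewrite -(opprB x xs) !norm2_sqr (grad_minimizer f m L xs (ltW m0) L0)//.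
  rewrite -[in inner 0 _](scale0r (x - xs)) !innerE; lra.
rewrite !norm2_sqr; move: (grad f x) (x - xs) coc mono => G D coc mono.
have h0 := inner_ge0 (G - m *: D).
move: coc mono h0; rewrite !innerE (innerC D G).
move: hc; have S0 : 0 < L + m by rewrite addr_gt0.
rewrite ler_pdivlMr//; move: (inner G G) (inner G D) (inner D D) => a b e.
move=> hc coc mono h0; have a_ge : m ^+ 2 * e <= a by nra.
have h1 : 0 <= c * (2 - c * (L + m)) * (a - m ^+ 2 * e).
  by rewrite !mulr_ge0 ?subr_ge0.
have h2 : 0 <= 2 * c * ((m + L) * b - (a + m * L * e)).
  by rewrite !mulr_ge0 ?subr_ge0.
rewrite -(ler_pM2l S0); lra.
Qed.

End Contraction.

(** * Quadratics attain the contraction factor *)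

Section QuadraticProblem.
Context {R : realType} {d : nat}.
Implicit Types (x y xs v : 'rV[R]_d) (m : R).

Definition quadratic m xs x : R := m / 2 * inner (x - xs) (x - xs).

Lemma differentiable_quadratic m xs x : differentiable (quadratic m xs) x.
Proof.
have -> : quadratic m xs = (m / 2) *:
    \sum_(j < d) ((fun y : 'rV[R]_d => y 0 j : R) - cst (xs 0 j)) ^+ 2.
  apply/funext => y; rewrite /quadratic fct_sumE /inner /=; congr (_ * _).
  by apply: eq_bigr => j _; rewrite !mxE expr2.
apply: differentiableZ; apply: differentiable_sum => j; apply: differentiableX.
by apply: differentiableB => //; exact: differentiable_coord.
Qed.

Lemma derive_quadratic m xs x v :
  'D_v (quadratic m xs) x = m * inner (x - xs) v.
Proof.
apply/cvg_lim => //.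
have : (fun h : R => m * inner (x - xs) v + h * (m / 2 * inner v v)) @ 0^'
    --> m * inner (x - xs) v.
  set b := m * _; set e := _ * inner v v.
  rewrite -[X in _ --> X](addr0 b) -[X in _ --> b + X](mul0r e).
  apply: cvgD; first exact: cvg_cst.
  by apply: cvgMr_tmp; apply: cvg_within_filter; exact: cvg_id.
apply: cvg_trans; apply: near_eq_cvg; near=> h.
have h0 : h != 0 by near: h; exact: nbhs_dnbhs_neq.
rewrite /quadratic /= /GRing.scale /= -addrA; move: (x - xs) => D.
by rewrite !innerE (innerC v D); field.
Unshelve. all: by end_near. Qed.

Lemma grad_quadratic m xs x : grad (quadratic m xs) x = m *: (x - xs).
Proof.
apply/rowP => j; rewrite mxE derive_quadratic !mxE; congr (_ * _).
rewrite /inner (bigD1 j)//= big1 => [|i ij]; rewrite !mxE ?eqxx ?mulr1 ?addr0//.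
by rewrite (negbTE ij) andbF mulr0.
Qed.

Lemma strongly_convex_quadratic m xs : strongly_convex m (quadratic m xs).
Proof.
move=> x y; rewrite grad_quadratic norm2_sqr /quadratic.
have -> : x - y = (x - xs) - (y - xs) by rewrite opprB addrA subrK.
move: (x - xs) (y - xs) => u v; rewrite !innerE (innerC v u); lra.
Qed.

Lemma lipschitz_grad_quadratic m L xs : 0 < m -> m <= L ->
  lipschitz_grad L (quadratic m xs).
Proof.
move=> m0 mL; split=> [x|x y]; first exact: differentiable_quadratic.
rewrite !grad_quadratic -scalerBr opprB addrA subrK.
rewrite -ler_sqr ?nnegrE ?mulr_ge0 ?norm2_ge0 ?(le_trans (ltW m0))//.
rewrite exprMn !norm2_sqr; move: (x - y) => u.
rewrite !innerE mulrA -expr2 ler_wpM2r ?inner_ge0//.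
by rewrite ler_sqr ?nnegrE ?(ltW m0) ?(le_trans (ltW m0)).
Qed.

Lemma minimizer_quadratic m xs : 0 < m -> minimizer (quadratic m xs) xs.
Proof.
move=> m0 y; rewrite /quadratic subrr -[in inner 0 _](scale0r 0) innerZl mul0r mulr0.
by rewrite mulr_ge0 ?inner_ge0// divr_ge0 ?(ltW m0).
Qed.

Lemma valid_quadratic n (mu L : 'I_n -> R) xs :
  (forall i, 0 < mu i) -> (forall i, mu i <= L i) ->
  valid_problem mu L xs (fun i => quadratic (mu i) xs).
Proof.
move=> mu0 muL i; split; first exact: strongly_convex_quadratic.
  exact: lipschitz_grad_quadratic.
exact: minimizer_quadratic.
Qed.

End QuadraticProblem.

(** * The squared distance along a fixed sequence of indices *)

Section SquaredDistance.
Context {R : realType} {n d : nat}.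
Implicit Types (f : 'I_n -> 'rV[R]_d -> R) (x xs : 'rV[R]_d).
Variables (mu L : 'I_n -> R) (gamma : R).
Hypotheses (mu0 : forall i, 0 < mu i) (muL : forall i, mu i <= L i).
Hypotheses (gamma0 : 0 <= gamma) (gammaE : forall i, gamma <= 2 / (L i + mu i)).

Definition contraction_factor i : R := (1 - gamma * mu i) ^+ 2.

Lemma iterate_sqdist_le f x xs s T : valid_problem mu L xs f ->
  norm2 (iterate f gamma x s T - xs) ^+ 2 <=
    \prod_(k < T) contraction_factor (s k) * norm2 (x - xs) ^+ 2.
Proof.
move=> fv; elim: T => [|T ih] /=; first by rewrite big_ord0 mul1r.
have [fm fL fmin] := fv (s T).
apply: (le_trans (gradient_step_contraction _ _ _ _ _ _ (mu0 _) (muL _)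
  fm fL fmin gamma0 (gammaE _))).
rewrite big_ord_recr /= (mulrC (\prod_(_ < _) _)).
by rewrite -(mulrA (contraction_factor _)) ler_wpM2l ?sqr_ge0.
Qed.

Lemma iterate_sqdist_quadratic x xs s T :
  norm2 (iterate (fun i => quadratic (mu i) xs) gamma x s T - xs) ^+ 2 =
    \prod_(k < T) contraction_factor (s k) * norm2 (x - xs) ^+ 2.
Proof.
rewrite !norm2_sqr; elim: T => [|T ih] /=; first by rewrite big_ord0 mul1r.
rewrite big_ord_recr /= (mulrC (\prod_(_ < _) _)).
rewrite -(mulrA (contraction_factor _)) -ih grad_quadratic.
move: (iterate _ _ _ _ _) => y; rewrite addrAC; move: (y - xs) => u.
by rewrite !innerE /contraction_factor; ring.
Qed.

End SquaredDistance.

(** * Maclaurin's inequality over permutations *)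

Section Shuffling.
Context {R : realFieldType} {n : nat}.
Variable a : 'I_n -> R.
Hypothesis a0 : forall i, 0 <= a i.

Lemma sum_perm_swap (F : {perm 'I_n} -> R) (p q : 'I_n) :
  (\sum_s F s = \sum_(s : {perm 'I_n}) F (tperm p q * s)%g)%R.
Proof. by rewrite (reindex_inj (mulgI (tperm p q))). Qed.

(** For [p >= c], exchanging the positions [c] and [p] does not affect the
    product, and the two sums are equal. For [p < c], write the product as
    [a (s p) * B s]; adding to the difference of the two sides its image under
    the same exchange leaves a sum of terms
    [B s * (a (s c) - a (s p)) ^+ 2]. *)
Lemma sum_perm_next_le (c p : 'I_n) :
  (\sum_(s : {perm 'I_n}) (\prod_(k < n | (k < c)%N) a (s k)) * a (s c) <=
   \sum_(s : {perm 'I_n}) (\prod_(k < n | (k < c)%N) a (s k)) * a (s p))%R.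
Proof.
have [cp|pc] := leqP c p.
  rewrite (sum_perm_swap _ c p) le_eqVlt; apply/orP; left; apply/eqP/eq_bigr => s _.
  rewrite permM tpermL; congr (_ * _)%R; apply: eq_bigr => k kc.
  by rewrite permM tpermD//; apply: contraTneq kc => <-; rewrite ?ltnn// -leqNgt.
set B := fun s : {perm 'I_n} => \prod_(k < n | (k < c)%N && (k != p)) a (s k).
have prodE (s : {perm 'I_n}) : \prod_(k < n | (k < c)%N) a (s k) = (a (s p) * B s)%R.
  by rewrite (bigD1 p).
rewrite -subr_ge0 -(pmulr_rge0 _ (ltr0Sn R 1)) mulr_natl mulr2n -sumrB.
rewrite [X in (_ <= X + _)%R](sum_perm_swap _ c p) -big_split.
rewrite sumr_ge0//= => s _.
have BE : B (tperm c p * s)%g = B s.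
  apply: eq_bigr => k /andP[kc kp]; rewrite permM tpermD// 1?eq_sym//.
  by apply: contraTneq kc => ->; rewrite ltnn.
rewrite !prodE BE !permM tpermL tpermR.
have -> : (a (s c) * B s * a (s c) - a (s c) * B s * a (s p) +
   (a (s p) * B s * a (s p) - a (s p) * B s * a (s c)) =
   B s * (a (s c) - a (s p)) ^+ 2)%R by ring.
by rewrite mulr_ge0 ?sqr_ge0// prodr_ge0.
Qed.

(** The inductive step bounds [n] times the sum for [c.+1] by summing
    [sum_perm_next_le] over all positions [p]: the values [a (s p)] add up to
    [\sum_i a i] for each permutation, which leaves the sum for [c]. *)
Lemma maclaurin_perm c : (c <= n)%N ->
  (\sum_(s : {perm 'I_n}) \prod_(k < n | (k < c)%N) a (s k) <=
   n`!%:R * ((\sum_i a i) / n%:R) ^+ c)%R.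
Proof.
elim: c => [|c ih] cn.
  rewrite (eq_bigr (fun=> 1%R)) => [|s _]; last by rewrite big_pred0.
  by rewrite sumr_const card_Sn expr0 mulr1.
have n0 : (0 < n%:R :> R)%R by rewrite ltr0n (leq_trans _ cn).
have step (s : {perm 'I_n}) : \prod_(k < n | (k < c.+1)%N) a (s k) =
    ((\prod_(k < n | (k < Ordinal cn)%N) a (s k)) * a (s (Ordinal cn)))%R.
  rewrite (bigD1 (Ordinal cn)) ?leqnn//= mulrC; congr (_ * _)%R.
  by apply: eq_bigl => k; rewrite -val_eqE /= ltnS ltn_neqAle andbC.
rewrite (eq_bigr _ (fun s _ => step s)) -(ler_pM2l n0).
rewrite -[X in (X%:R * _ <= _)%R](card_ord n) -sum1_card natr_sum mulr_suml.
apply: (@le_trans _ _ (\sum_p \sum_(s : {perm 'I_n})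
    (\prod_(k < n | (k < Ordinal cn)%N) a (s k)) * a (s p))%R).
  by apply: ler_sum => p _; rewrite mul1r sum_perm_next_le.
rewrite exchange_big /= (eq_bigr (fun s : {perm 'I_n} =>
    (\prod_(k < n | (k < c)%N) a (s k)) * \sum_i a i)%R).
  rewrite -mulr_suml exprSr; apply: le_trans (ler_wpM2r _ (ih (ltnW cn))) _.
    exact: sumr_ge0.
  rewrite le_eqVlt; apply/orP; left; apply/eqP.
  by field; rewrite gt_eqF.
move=> s _; rewrite -mulr_sumr; congr (_ * _)%R.
by rewrite [RHS](reindex_inj (@perm_inj _ s)).
Qed.

End Shuffling.

(** * Splitting a run into epochs *)

Section Epochs.
Context {R : realFieldType}.

(** [minn n (T - t * n)] is the number of steps of epoch [t] among the first
    [T] steps; it vanishes for the epochs that are not reached. *)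
Lemma sum_epoch_length n m T :
  (\sum_(t < m) minn n (T - t * n) = minn T (m * n))%N.
Proof.
elim: m => [|m ih]; first by rewrite big_ord0 mul0n minn0.
by rewrite big_ord_recr /= ih mulSn; lia.
Qed.

(** Letting [t] range over all [t < T] is harmless, since the epochs that are
    not reached contribute empty products. *)
Lemma prod_epochs (F : nat -> R) n T : (0 < n)%N ->
  \prod_(k < T) F k =
  \prod_(t < T) \prod_(j < n | (j < minn n (T - t * n))%N) F (t * n + j)%N.
Proof.
move=> n0; have Tn : (T <= T * n)%N by rewrite leq_pmulr.
rewrite (big_ord_widen _ F Tn) big_mkcond /=.
rewrite -(big_mkord xpredT (fun k => if (k < T)%N then F k else 1)) big_nat_mul.
rewrite big_mkord; apply: eq_bigr => t _.
rewrite mulSn addnC -{1}[(t * n)%N]add0n big_addn addKn big_mkord [RHS]big_mkcond.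
apply: eq_bigr => j _; rewrite addnC; congr (if _ then _ else _).
by have := ltn_ord j; lia.
Qed.

(** The parameter [e] stands for any total map that numbers the epochs by
    ['I_T]. *)
Lemma shuffle_sum_le n T (a : 'I_n -> R) (hn : (0 < n)%N)
    (e : nat -> 'I_T) :
  (forall i, 0 <= a i) -> (forall k, (k < T)%N -> e k = k :> nat) ->
  \sum_(v : {ffun 'I_T -> {perm 'I_n}})
    \prod_(k < T) a (v (e (k %/ n)%N) (Ordinal (ltn_pmod k hn)))
    <= n`!%:R ^+ T * ((\sum_i a i) / n%:R) ^+ T.
Proof.
move=> a0 eE.
have prodE (v : {ffun 'I_T -> {perm 'I_n}}) :
    \prod_(k < T) a (v (e (k %/ n)%N) (Ordinal (ltn_pmod k hn))) =
    \prod_(t < T) \prod_(j < n | (j < minn n (T - t * n))%N) a (v t j).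
  rewrite (prod_epochs
    (fun k => a (v (e (k %/ n)%N) (Ordinal (ltn_pmod k hn)))) n T hn).
  apply: eq_bigr => t _; apply: eq_bigr => j _.
  congr (a (fun_of_perm (v _) _)); apply: val_inj => /=.
    by rewrite divnMDl// divn_small// addn0 eE.
  by rewrite modnMDl modn_small.
rewrite (eq_bigr _ (fun v _ => prodE v)).
rewrite -(bigA_distr_bigA (fun (t : 'I_T) (s : {perm 'I_n}) =>
  \prod_(j < n | (j < minn n (T - t * n))%N) a (s j))).
have -> : n`!%:R ^+ T * ((\sum_i a i) / n%:R) ^+ T =
    \prod_(t < T) (n`!%:R * ((\sum_i a i) / n%:R) ^+ minn n (T - t * n)).
  rewrite big_split /= prodr_const card_ord prodrXr sum_epoch_length.
  congr (_ * _ ^+ _).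
  by apply/esym/minn_idPl; rewrite leq_pmulr.
apply: ler_prod => t _; rewrite maclaurin_perm ?geq_minl// andbT.
by apply: sumr_ge0 => s _; exact: prodr_ge0.
Qed.

End Epochs.

(** * Expectations of functions of finitely many finite random variables *)

Section FiniteExpectation.
Context {R : realType} {disp : measure_display} {Omega : measurableType disp}.
Variable P : probability Omega R.
Local Open Scope ereal_scope.

Lemma expectation_finite (W : finType) (Z : Omega -> W) (g : W -> R) :
  (forall v, measurable (Z @^-1` [set v])) -> (forall v, 0 <= g v)%R ->
  'E_P[(fun w => g (Z w))] = \sum_v (g v)%:E * P (Z @^-1` [set v]).
Proof.
move=> mZ g0; rewrite unlock.
have gE w : (g (Z w))%:E = \sum_v (g v * \1_(Z @^-1` [set v]) w)%:E.
  rewrite (bigD1 (Z w))//= big1 => [|v vZ]; rewrite indicE.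
    by rewrite mem_set// mulr1 adde0.
  by rewrite memNset ?mulr0//= => Zv; rewrite Zv eqxx in vZ.
under eq_integral do rewrite gE.
rewrite ge0_integral_sum//=; first last.
- by move=> v w _; rewrite lee_fin mulr_ge0.
- by move=> v; apply/measurable_EFinP/measurable_funM.
apply: eq_bigr => v _; rewrite (integralZl_indic _ (fun=> Z @^-1` [set v]))//.
  by rewrite integral_indic// setIT.
by move=> gv; have := g0 v; rewrite leNgt gv.
Qed.

Lemma expectation_iid_uniform (V : finType) (X : nat -> Omega -> V) m
    (g : {ffun 'I_m -> V} -> R) :
  iid_uniform P X -> (forall v, 0 <= g v)%R ->
  'E_P[(fun w => g [ffun k : 'I_m => X k w])] =
  (#|V|%:R^-1 ^+ m * \sum_v g v)%:E.
Proof.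
move=> [mX uX iX] g0.
(* Mutual independence is applied to the full set setT outside 'I_m. *)
pose A (v : {ffun 'I_m -> V}) (k : nat) : set V :=
  if insub k is Some i then [set v i] else setT.
have [J JE] : exists J : {fset nat}, J =i iota 0 m.
  by exists (seq_fset tt (iota 0 m)); exact: seq_fsetE.
have AE v : (fun w => [ffun k : 'I_m => X k w]) @^-1` [set v] =
    \bigcap_(k in [set` J]) (X k @^-1` A v k).
  apply/seteqP; split => w /=.
    move=> <- k /=; rewrite JE mem_iota /= add0n => km.
    by rewrite /A insubT /= ffunE.
  move=> h; apply/ffunP => k; rewrite ffunE.
  have /(_ _) := h k; rewrite /= JE mem_iota /= ltn_ord => /(_ isT).
  by rewrite /A /= valK.
have mA v k : measurable (X k @^-1` A v k).
  rewrite /A; case: insubP => [i _ _|_]; first exact: mX.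
  by rewrite preimage_setT.
rewrite (expectation_finite _ (fun w => [ffun k : 'I_m => X k w])) => // [|v]; last first.
  by rewrite AE; apply: fin_bigcap_measurable => // k _; exact: mA.
rewrite mulr_sumr -sumEFin; apply: eq_bigr => v _.
rewrite AE iX (perm_big (iota 0 m)) /=; last first.
  by apply: uniq_perm; rewrite ?fset_uniq ?iota_uniq.
rewrite -[m in iota 0 m]subn0 -/(index_iota 0 m) big_mkord.
rewrite (eq_bigr (fun=> (#|V|%:R^-1)%:E)) => [|k _]; last first.
  by rewrite /A valK uX.
by rewrite prodEFin prodr_const card_ord muleC.
Qed.

End FiniteExpectation.

(** * The worst case for a given sampling scheme *)

Section WorstCase.
Context {R : realType} {n d : nat}.
Variables (mu L : 'I_n -> R) (gamma : R).
Hypotheses (mu0 : forall i, 0 < mu i) (muL : forall i, mu i <= L i).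
Hypotheses (gamma0 : 0 <= gamma) (gammaE : forall i, gamma <= 2 / (L i + mu i)).
Context {disp : measure_display} {Omega : measurableType disp}.
Variables (P : probability Omega R) (V : finType) (X : nat -> Omega -> V).
Hypothesis iidX : iid_uniform P X.
Variables (T : nat) (s : nat -> Omega -> 'I_n).
(* Both sampling schemes decode their indices from T independent uniform
   variables: indices in one case, permutations in the other. *)
Variable dec : {ffun 'I_T -> V} -> nat -> 'I_n.
Hypothesis decE : forall k w, (k < T)%N ->
  s k w = dec [ffun j : 'I_T => X j w] k.

Lemma eq_iterate (f : 'I_n -> 'rV[R]_d -> R) x (u v : nat -> 'I_n) m :
  (forall k, (k < m)%N -> u k = v k) ->
  iterate f gamma x u m = iterate f gamma x v m.
Proof.
elim: m => //= m ih uv; rewrite uv// ih// => k km; apply: uv; exact: ltnW.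
Qed.

Lemma expected_sqdist_average f (x xs : 'rV[R]_d) :
  expected_sqdist P s f gamma x xs T =
  (#|V|%:R^-1 ^+ T * \sum_v norm2 (iterate f gamma x (dec v) T - xs) ^+ 2)%:E.
Proof.
rewrite -(expectation_iid_uniform P V X T) => [||v]; last exact: sqr_ge0; last by [].
rewrite /expected_sqdist; congr expectation; apply/funext => w.
by rewrite (eq_iterate _ _ _ (dec [ffun j : 'I_T => X j w]))// => k kT; rewrite decE.
Qed.

(** The bound of [iterate_sqdist_le] holds with equality, realisation by
    realisation, for the quadratics, so averaging preserves the maximality. *)
Lemma is_max_expected_sqdists (xs : 'rV[R]_d) r : (0 < d)%N -> 0 <= r ->
  is_max (expected_sqdists P mu L xs r gamma T s)
    (#|V|%:R^-1 ^+ T *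
     \sum_v \prod_(k < T) contraction_factor mu gamma (dec v k) * r ^+ 2)%:E.
Proof.
move=> d0 r0; split.
  exists (fun i => quadratic (mu i) xs), (xs + r *: delta_mx 0 (Ordinal d0)).
  have nr : norm2 (xs + r *: delta_mx 0 (Ordinal d0) - xs) ^+ 2 = r ^+ 2.
    rewrite addrC addKr norm2_sqr !innerE mulrA -expr2.
    rewrite /inner (bigD1 (Ordinal d0))//= big1 => [|i ij];
      rewrite !mxE ?eqxx ?mulr1 ?addr0 ?mulr1//.
    by rewrite (negbTE ij) andbF mulr0.
  split; first exact: valid_quadratic.
    by rewrite -ler_sqr ?nnegrE ?norm2_ge0// nr.
  rewrite expected_sqdist_average; congr (_ * _)%:E; apply: eq_bigr => v _.
  by rewrite iterate_sqdist_quadratic nr.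
move=> _ [f [x [fv xr ->]]]; rewrite expected_sqdist_average lee_fin.
rewrite ler_wpM2l ?exprn_ge0 ?invr_ge0//; apply: ler_sum => v _.
apply: le_trans
  (iterate_sqdist_le mu L gamma mu0 muL gamma0 gammaE _ _ _ _ _ fv) _.
rewrite ler_wpM2l ?prodr_ge0// => [k _|]; first exact: sqr_ge0.
by rewrite ler_sqr ?nnegrE ?norm2_ge0.
Qed.

End WorstCase.

(** * Comparison of the two schemes *)

Theorem theorem7 (R : realType) (n d : nat) (hn : (0 < n)%N) (hd : (1 <= d)%N)
  (mu L : 'I_n -> R)
  (hmu : forall i, 0 < mu i) (hL : forall i, 0 < L i)
  (hmuL : forall i, mu i <= L i)
  (xstar : 'rV[R]_d) (r : R) (hr : 0 < r)
  (d1 : measure_display) (Omega1 : measurableType d1)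
  (P1 : probability Omega1 R) (sRS : nat -> Omega1 -> 'I_n)
  (hRS : random_shuffle P1 sRS)
  (d2 : measure_display) (Omega2 : measurableType d2)
  (P2 : probability Omega2 R) (sSGD : nat -> Omega2 -> 'I_n)
  (hSGD : with_replacement P2 sSGD)
  (gamma : R) (hgamma0 : 0 < gamma)
  (hgamma : forall i, gamma <= 2 / (L i + mu i))
  (T : nat) (hT : (1 <= T)%N) :
  exists maxRS maxSGD : \bar R,
    [/\ is_max (expected_sqdists P1 mu L xstar r gamma T sRS) maxRS,
        is_max (expected_sqdists P2 mu L xstar r gamma T sSGD) maxSGD
      & (maxRS <= maxSGD)%E].
Proof.
have [sigma [iid_sigma sRSE]] := hRS.
(* The default value is never reached for the steps and epochs in use. *)
pose e := insubd (Ordinal hT).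
have eE k : (k < T)%N -> e k = k :> nat by rewrite val_insubd => ->.
pose decSGD (v : {ffun 'I_T -> 'I_n}) k := v (e k).
pose decRS (v : {ffun 'I_T -> {perm 'I_n}}) k :=
  v (e (k %/ n)%N) (Ordinal (ltn_pmod k hn)).
have hSGDdec k w : (k < T)%N ->
    sSGD k w = decSGD [ffun j : 'I_T => sSGD j w] k.
  by move=> kT; rewrite /decSGD ffunE eE.
have hRSdec k w : (k < T)%N ->
    sRS k w = decRS [ffun j : 'I_T => sigma j w] k.
  move=> kT; rewrite /decRS ffunE eE ?(leq_ltn_trans (leq_div _ _))//.
  by rewrite -sRSE /= -divn_eq.
have g0 := ltW hgamma0; have r0 := ltW hr.
do 2 eexists; split.
- exact: (is_max_expected_sqdists mu L gamma hmu hmuL g0 hgamma P1 _ _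
    iid_sigma T sRS decRS hRSdec xstar r hd r0).
- exact: (is_max_expected_sqdists mu L gamma hmu hmuL g0 hgamma P2 _ _
    hSGD T sSGD decSGD hSGDdec xstar r hd r0).
set a := contraction_factor mu gamma.
have a0 i : 0 <= a i by exact: sqr_ge0.
rewrite lee_fin -!mulr_suml; move: (r ^+ 2) (sqr_ge0 r) => q q0.
rewrite !mulrA ler_wpM2r// card_ord card_Sn.
have -> : \sum_(v : {ffun 'I_T -> 'I_n}) \prod_(k < T) a (decSGD v k) =
    (\sum_i a i) ^+ T.
  rewrite -[in RHS](card_ord T) -prodr_const (bigA_distr_bigA (fun=> a)).
  apply: eq_bigr => v _; apply: eq_bigr => k _.
  by rewrite /decSGD; congr (a (v _)); apply: val_inj; exact: eE.
rewrite -exprMn exprVn ler_pdivrMl ?exprn_gt0 ?ltr0n ?fact_gt0//.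
by rewrite [_^-1 * _]mulrC; exact: shuffle_sum_le.
Qed.
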